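(* Let $A\in\Gamma$ be a formal power series of the form $A=z^rR(z^m)$, where $R\in k[[z]]$ and $m\ge2$, $r\ge0$ are integers. Then for any decomposition $A=A_1\circ A_2$ with $A_1,A_2\in\Gamma$, there exist $\mu\in k_1[[z]]$ and $R_1,R_2\in k[[z]]$ such that $$A_1=z^{r_1}R_1\bigl(z^{\frac{m}{\gcd(r_2,m)}}\bigr)\circ\mu^{-1},\qquad A_2=\mu\circ z^{r_2}R_2(z^m)$$ for some integers $r_1,r_2\ge0$ satisfying $r_1r_2\equiv r\pmod m$.
   Context: $k$ is an algebraically closed field of characteristic zero and $k[[z]]$ is the ring of formal power series over $k$. The order of a nonzero series is the smallest exponent with nonzero coefficient. $k_1[[z]]$ is the group under composition $\circ$ of series of order exactly $1$ ($\mu^{-1}$ is the compositional inverse), and $\Gamma$ is the semigroup under $\circ$ of (nonzero) series of order at least $2$. Here $\gcd(0,m)=m$. *)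

(* Defs.v *)
From mathcomp Require Import all_boot all_order all_algebra.

Set Implicit Arguments.
Unset Strict Implicit.
Unset Printing Implicit Defensive.

Import GRing.Theory.
Local Open Scope ring_scope.

(* A series is its coefficient sequence; two series are equal when their
   coefficients agree, which is the pointwise equality [=1]. *)
Definition fps (k : fieldType) := nat -> k.

Declare Scope fps_scope.
Delimit Scope fps_scope with fps.
Bind Scope fps_scope with fps.

Definition fps_one (k : fieldType) : fps k := fun n => (n == 0%N)%:R.
Definition fps_z (k : fieldType) : fps k := fun n => (n == 1%N)%:R.

Definition fps_mul (k : fieldType) (f g : fps k) : fps k :=
  fun n => \sum_(i < n.+1) f i * g (n - i)%N.

Definition fps_exp (k : fieldType) (f : fps k) (n : nat) : fps k :=
  iter n (fps_mul f) (fps_one k).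

(* The composition f(g(z)) is meaningful only if g has zero constant term.
   Then g^i has order at least i, so the coefficient of z^n in the sum of the
   f_i g^i involves only the indices i <= n.  When the constant term of g is
   nonzero, the value below is junk. *)
Definition fps_comp (k : fieldType) (f g : fps k) : fps k :=
  fun n => \sum_(i < n.+1) f i * fps_exp g i n.

Notation "'z" := (fps_z _) (at level 0) : fps_scope.
Notation "f * g" := (fps_mul f g) : fps_scope.
Notation "f ^+ n" := (fps_exp f n) : fps_scope.
Notation "f \oz g" := (fps_comp f g) (at level 50, left associativity)
  : fps_scope.

Definition has_order (k : fieldType) (f : fps k) (n : nat) : Prop :=
  f n != 0 /\ forall i, (i < n)%N -> f i = 0.

Definition in_k1 (k : fieldType) (f : fps k) : Prop := has_order f 1.

Definition in_Gamma (k : fieldType) (f : fps k) : Prop :=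
  exists2 n, (2 <= n)%N & has_order f n.

Definition is_comp_inverse (k : fieldType) (mu nu : fps k) : Prop :=
  [/\ in_k1 nu, fps_comp mu nu =1 fps_z k & fps_comp nu mu =1 fps_z k].

(* Main.v *)
Require Import Defs.
From mathcomp Require Import all_boot all_order all_algebra.

(** Write [A1 = g^n] with [n] the order of [A1] and [g] of order one: [g] exists
    because the field is closed of characteristic zero.  Take [mu] to be the
    compositional inverse of [g], and [B = g o A2].  Then [A1 = z^n o mu^-1],
    so [R1 = 1] works, [A2 = mu o B], and [B^n = A].  It remains to see that the
    exponents of [B] are all congruent to its order [e]: if the first bad one is
    [e + j], then the coefficient of [z^(e n + j)] in [A = B^n] is
    [n B_e^(n-1) B_(e+j)], which is nonzero although [e n + j] and the order
    [e n] of [A] are not congruent modulo [m]. *)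

Section PowerSeries.

Set Implicit Arguments.
Unset Strict Implicit.
Unset Printing Implicit Defensive.
Import GRing.Theory.
Local Open Scope ring_scope.

(** * Truncation *)

Section Truncation.
Variable k : fieldType.
Implicit Types (f g h : fps k) (p q : {poly k}).

(** Congruence modulo [z^N]. Series are bare functions here, without a ring structure, so identities
    between them are proved on polynomials and transferred through [approx]. *)
Definition approx (N : nat) p f := forall i, (i < N)%N -> p`_i = f i.

Definition trunc (N : nat) f : {poly k} := \poly_(i < N) f i.

Lemma approx_trunc N f : approx N (trunc N f) f.
Proof. by move=> i ltiN; rewrite coef_poly ltiN. Qed.

Lemma approx_one N : approx N 1 (fps_one k).
Proof. by move=> i _; rewrite coef1. Qed.

Lemma approx_z N : approx N 'X (fps_z k).
Proof. by move=> i _; rewrite coefX. Qed.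

Lemma approx_mul N p q f g :
  approx N p f -> approx N q g -> approx N (p * q) (f * g)%fps.
Proof.
move=> pf qg i ltiN; rewrite coefM; apply: eq_bigr => j _.
have leji : (j <= i)%N by rewrite -ltnS.
by rewrite pf ?qg // (leq_ltn_trans _ ltiN) ?leq_subr.
Qed.

Lemma approx_exp N p f n : approx N p f -> approx N (p ^+ n) (f ^+ n)%fps.
Proof.
move=> pf; elim: n => [|n IHn]; first exact: approx_one.
by rewrite exprS; apply: approx_mul.
Qed.

Lemma dvdXn_drop e p : (forall i, (i < e)%N -> p`_i = 0) ->
  p = drop_poly e p * 'X^e.
Proof.
move=> p0; apply/polyP=> i; rewrite coefMXn.
by case: ltnP => [/p0//|leei]; rewrite coef_drop_poly subnK.
Qed.

Lemma coef_exp_lt p n i : p`_0 = 0 -> (i < n)%N -> (p ^+ n)`_i = 0.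
Proof.
move=> p0 ltin; rewrite (@dvdXn_drop 1 p) => [|[]//].
by rewrite expr1 exprMn coefMXn ltin.
Qed.

Lemma approx_comp N p q f g : g 0%N = 0 ->
  approx N p f -> approx N q g -> approx N (p \Po q) (f \oz g)%fps.
Proof.
move=> g0 pf qg i ltiN; rewrite coef_comp_poly.
have q0 : q`_0 = 0 by rewrite qg // (leq_ltn_trans _ ltiN).
pose F j := p`_j * (q ^+ j)`_i.
(* The two sums stop at [size p] and at [i.+1]. Both are extended to the larger bound; an extra term
   vanishes because [p] has no such coefficient or because [q ^+ j] has order at least [j > i]. *)
rewrite -(big_mkord xpredT F) (big_nat_widen _ _ (maxn (size p) i.+1)) ?leq_maxl //.
have -> : (f \oz g)%fps i = \sum_(0 <= j < i.+1) F j.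
  rewrite big_mkord; apply: eq_bigr => j _.
  by rewrite /F pf ?(approx_exp _ qg) // (leq_ltn_trans _ ltiN) // -ltnS.
rewrite [RHS](big_nat_widen _ _ (maxn (size p) i.+1)) ?leq_maxr //.
rewrite big_mkcond [RHS]big_mkcond; apply: eq_bigr => j _ /=.
case: (ltnP j (size p)) => [_|lepj]; case: (ltnP j i.+1) => // ltij.
  by rewrite /F coef_exp_lt ?mulr0.
by rewrite /F nth_default ?mul0r.
Qed.

Lemma approx_eq f g :
  (forall N, exists2 p, approx N p f & approx N p g) -> f =1 g.
Proof. by move=> fg i; have [p pf pg] := fg i.+1; rewrite -pf // pg. Qed.

Lemma eq_fps_mul f f' g g' : f =1 f' -> g =1 g' -> (f * g =1 f' * g')%fps.
Proof. by move=> ff gg i; apply: eq_bigr => j _; rewrite ff gg. Qed.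

Lemma eq_fps_exp f f' n : f =1 f' -> (f ^+ n =1 f' ^+ n)%fps.
Proof. by move=> ff; elim: n => //= n; apply: eq_fps_mul. Qed.

Lemma eq_fps_comp f f' g g' : f =1 f' -> g =1 g' -> (f \oz g =1 f' \oz g')%fps.
Proof.
by move=> ff gg i; apply: eq_bigr => j _; rewrite ff (eq_fps_exp j gg).
Qed.

Lemma fps_exp0 f : (f ^+ 0 =1 fps_one k)%fps.
Proof. by []. Qed.

Lemma fps_exp1 f : (f ^+ 1 =1 f)%fps.
Proof.
apply: approx_eq => N; have tf := @approx_trunc N f.
by exists (trunc N f) => //; rewrite -[trunc _ _]expr1; apply: approx_exp.
Qed.

Lemma fps_mulf1 f : (f * fps_one k =1 f)%fps.
Proof. exact: fps_exp1. Qed.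

Lemma fps_comp0 f g : (f \oz g)%fps 0%N = f 0%N.
Proof. by rewrite /fps_comp big_ord1 /= /fps_one eqxx mulr1. Qed.

Lemma fps_comp_exp f g n : g 0%N = 0 ->
  ((f ^+ n) \oz g =1 (f \oz g) ^+ n)%fps.
Proof.
move=> g0; apply: approx_eq => N.
have [tf tg] := (@approx_trunc N f, @approx_trunc N g).
exists ((trunc N f ^+ n) \Po trunc N g).
  exact/approx_comp/tg/approx_exp.
by rewrite rmorphXn; apply/approx_exp/approx_comp.
Qed.

Lemma fps_compA f g h : g 0%N = 0 -> h 0%N = 0 ->
  (f \oz g \oz h =1 f \oz (g \oz h))%fps.
Proof.
move=> g0 h0; apply: approx_eq => N.
have [tf [tg th]] := (@approx_trunc N f, (@approx_trunc N g, @approx_trunc N h)).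
exists ((trunc N f \Po trunc N g) \Po trunc N h).
  exact: (approx_comp h0 (approx_comp g0 tf tg) th).
rewrite -comp_polyA.
by apply: (approx_comp _ tf (approx_comp h0 tg th)); rewrite fps_comp0.
Qed.

Lemma fps_comp_z f : (f \oz fps_z k =1 f)%fps.
Proof.
apply: approx_eq => N; have tf := @approx_trunc N f.
exists (trunc N f) => //; rewrite -[trunc _ _]comp_polyXr.
exact: (approx_comp _ tf (@approx_z N)).
Qed.

Lemma fps_z_comp f : f 0%N = 0 -> (fps_z k \oz f =1 f)%fps.
Proof.
move=> f0; apply: approx_eq => N; have tf := @approx_trunc N f.
exists (trunc N f) => //; rewrite -[trunc _ _]comp_polyX.
exact: (approx_comp f0 (@approx_z N) tf).
Qed.

Lemma fps_zXM n f i :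
  ('z ^+ n * f)%fps i = if (i < n)%N then 0 else f (i - n)%N.
Proof.
have [pz tf] := (approx_exp n (@approx_z i.+1), @approx_trunc i.+1 f).
rewrite -(approx_mul pz tf) // coefXnM.
by case: ltnP => // _; rewrite tf // ltnS leq_subr.
Qed.

Lemma fps_zX n i : ('z ^+ n)%fps i = (i == n)%:R :> k.
Proof. by rewrite -(approx_exp n (@approx_z i.+1)) // coefXn. Qed.

Lemma fps_comp_zX f m i : (0 < m)%N ->
  (f \oz 'z ^+ m)%fps i = if (m %| i)%N then f (i %/ m)%N else 0.
Proof.
move=> m0; have [pz tf] := (approx_exp m (@approx_z i.+1), @approx_trunc i.+1 f).
rewrite -(approx_comp _ tf pz) // ?fps_zX; last by case: (m) m0.
rewrite coef_comp_poly_Xn //; case: ifP => // _.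
by rewrite tf // ltnS leq_div.
Qed.

Lemma fps_one_comp g : (fps_one k \oz g =1 fps_one k)%fps.
Proof.
move=> i; rewrite /fps_comp big_ord_recl big1 /=; last first.
  by move=> j _; rewrite /fps_one /= mul0r.
by rewrite addr0 /fps_one /= mul1r.
Qed.

(** * Leading and first differing coefficients of powers *)

Definition vanishes_below (e : nat) f := forall i, (i < e)%N -> f i = 0.

Lemma vanishes_below1 f : f 0%N = 0 -> vanishes_below 1 f.
Proof. by move=> f0 []. Qed.

Lemma sub_expXn (p q c : {poly k}) e j n : p - q = c * 'X^j ->
  (p * 'X^e) ^+ n - (q * 'X^e) ^+ n =
  (c * \sum_(i < n) p ^+ (n.-1 - i) * q ^+ i) * 'X^(e * n + j).
Proof.
move=> pq; rewrite !exprMn -mulrBl subrXX pq -exprM exprD.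
by rewrite (mulrAC c) [RHS]mulrA [LHS]mulrAC.
Qed.

(* With [f = z^e p], [g = z^e q] and [p - q = z^j c], the difference of the
   [n]-th powers is [z^(e n + j) c (p^(n-1) + p^(n-2) q + ... + q^(n-1))]. *)
Lemma fps_exp_sub e j n f g :
    vanishes_below e f -> vanishes_below e g ->
    (forall i, (i < j)%N -> f (e + i)%N = g (e + i)%N) ->
  (forall i, (i < e * n + j)%N -> (f ^+ n)%fps i = (g ^+ n)%fps i) /\
  ((0 < j)%N -> (f ^+ n)%fps (e * n + j)%N - (g ^+ n)%fps (e * n + j)%N =
     (f (e + j)%N - g (e + j)%N) * (f e ^+ n.-1 *+ n)).
Proof.
(* Precision sufficient both for the coefficient [e * n + j] of the powers and for the coefficient
   [e + j] of [f] and [g]. *)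
move=> f0 g0 fg; set N := (e * n + (e + j)).+1.
have [tf tg] := (@approx_trunc N f, @approx_trunc N g).
have leN a : (a <= e + j)%N -> (a < N)%N.
  by move=> lea; rewrite ltnS (leq_trans lea) // leq_addl.
have leeN a : (a < e)%N -> (a < N)%N.
  by move=> /ltnW lta; apply/leN/(leq_trans lta)/leq_addr.
have Df := @dvdXn_drop e (trunc N f) (fun i lt => etrans (tf i (leeN i lt)) (f0 i lt)).
have Dg := @dvdXn_drop e (trunc N g) (fun i lt => etrans (tg i (leeN i lt)) (g0 i lt)).
set p := drop_poly e _ in Df; set q := drop_poly e _ in Dg.
have pE i : (i <= j)%N -> p`_i = f (e + i)%N.
  by move=> leij; rewrite coef_drop_poly addnC tf // leN // leq_add2l.
have qE i : (i <= j)%N -> q`_i = g (e + i)%N.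
  by move=> leij; rewrite coef_drop_poly addnC tg // leN // leq_add2l.
have pq : p - q = drop_poly j (p - q) * 'X^j.
  apply: dvdXn_drop => i ltij.
  by rewrite coefB pE ?qE 1?ltnW // fg ?subrr.
have diffE i : (i <= e * n + j)%N -> (f ^+ n)%fps i - (g ^+ n)%fps i =
    ((drop_poly j (p - q) * \sum_(i < n) p ^+ (n.-1 - i) * q ^+ i)
       * 'X^(e * n + j))`_i.
  move=> lei; have ltiN : (i < N)%N.
    by rewrite ltnS (leq_trans lei) // leq_add2l leq_addl.
  rewrite -(sub_expXn _ _ pq) -Df -Dg coefB.
  by rewrite (approx_exp n tf) // (approx_exp n tg).
split=> [i lti | j0].
  by apply/eqP; rewrite -subr_eq0 diffE 1?ltnW // coefMXn lti.
rewrite diffE // coefMXn ltnn subnn coef0M coef_drop_poly add0n coefB.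
rewrite pE // qE //; congr (_ * _).
(* Since [j > 0], both cofactors have constant term [f e], so each of the [n] summands has constant
   term [f e ^+ n.-1]. *)
have p0 : p`_0 = f e by rewrite pE // addn0.
have q0 : q`_0 = f e by rewrite qE // -fg // addn0.
rewrite -horner_coef0 horner_sum -[n in _ *+ n]card_ord -sumr_const.
apply: eq_bigr => i _; rewrite hornerM !horner_exp !horner_coef0 p0 q0 -exprD.
by rewrite subnK // -ltnS prednK // (leq_ltn_trans _ (ltn_ord i)).
Qed.

Lemma fps_exp_lead e n f : vanishes_below e f ->
  vanishes_below (e * n) (f ^+ n)%fps /\ (f ^+ n)%fps (e * n)%N = f e ^+ n.
Proof.
move=> f0; set N := (e * n + e).+1; have tf := @approx_trunc N f.
have Df : trunc N f = drop_poly e (trunc N f) * 'X^e.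
  apply: dvdXn_drop => i lti; rewrite tf ?f0 //.
  by rewrite ltnS (leq_trans (ltnW lti)) // leq_addl.
have expE i : (i <= e * n)%N ->
    (f ^+ n)%fps i = (drop_poly e (trunc N f) ^+ n * 'X^(e * n))`_i.
  move=> lei; rewrite -(approx_exp n tf); first by rewrite exprM -exprMn -Df.
  by rewrite ltnS (leq_trans lei) // leq_addr.
split=> [i lti|]; first by rewrite expE 1?ltnW // coefMXn lti.
rewrite expE // coefMXn ltnn subnn -horner_coef0 horner_exp horner_coef0.
by rewrite coef_drop_poly tf // ltnS leq_addl.
Qed.

End Truncation.

(** * Roots and compositional inverses *)

(** Recursive construction of a series: the prefix is kept as a list, and the next entry is chosen
    from it. Locality of [P] carries each condition from the prefix to the limit. *)
Lemma coefficientwise_choice (T : choiceType) (x0 : T)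
    (P : (nat -> T) -> nat -> bool) :
    (forall g h n, (forall i, (i <= n)%N -> g i = h i) -> P g n -> P h n) ->
    (forall g n, (forall j, (j < n)%N -> P g j) ->
       exists c, P (fun i => if i == n then c else g i) n) ->
  exists g, forall n, P g n.
Proof.
move=> locP extP.
pose upd (g : nat -> T) (n : nat) (c : T) := fun i => if i == n then c else g i.
(* The implication makes the existence unconditional, so [xchoose] applies before the prefix is
   known to be good. *)
have ex g n : exists c, [forall j : 'I_n, P g j] ==> P (upd g n c) n.
  case: (boolP [forall j : 'I_n, P g j]) => [/forallP Pg|_]; last by exists x0.
  by apply: extP => j ltj; apply: (Pg (Ordinal ltj)).
pose next s := rcons s (xchoose (ex (nth x0 s) (size s))).
pose S n := iter n next [::].
pose g i := nth x0 (S i.+1) i.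
have sizeS n : size (S n) = n by elim: n => //= n IHn; rewrite size_rcons IHn.
have nthS n i : (i < n)%N -> nth x0 (S n) i = g i.
  elim: n => // n IHn; rewrite ltnS leq_eqVlt => /predU1P[-> //|lti].
  by rewrite /S iterS nth_rcons sizeS lti IHn.
exists g; elim/ltn_ind => n IHn.
have := xchooseP (ex (nth x0 (S n)) (size (S n))).
(* Naming the chosen value keeps the rewriting by [sizeS] out of the proof term inside [xchoose]. *)
have [c defc] : exists c, xchoose (ex (nth x0 (S n)) (size (S n))) = c by eexists.
rewrite defc sizeS => /implyP impP.
have Pn : P (upd (nth x0 (S n)) n c) n.
  apply: impP; apply/forallP=> j; apply: locP (IHn j (ltn_ord j)) => i lei.
  by rewrite nthS // (leq_ltn_trans lei).
apply: locP Pn => i lei; rewrite /upd; case: eqP => [->|/eqP nin].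
  by rewrite -defc /g /S iterS nth_rcons -/(S n) sizeS ltnn eqxx.
by rewrite nthS // ltn_neqAle nin.
Qed.

(** The first equation is [g_1^n = f_n], solvable in a closed field. Each later coefficient of [g]
    enters its equation linearly with slope [n g_1^(n-1)], nonzero in characteristic zero. *)
Lemma fps_root (k : closedFieldType) (f : fps k) n :
    [pchar k] =i pred0 -> (0 < n)%N -> has_order f n ->
  exists2 g, in_k1 g & (g ^+ n =1 f)%fps.
Proof.
move=> char0 n0 [fn fle].
(* The coefficient [j.+1] of [g] is governed by the coefficient [n + j] of [g^n]. Repeating
   [g 0 = 0] in each condition makes [fps_exp_sub] available in the locality proof. *)
pose P (g : fps k) i := if i is j.+1 then
  (g 0%N == 0) && ((g ^+ n)%fps (n + j)%N == f (n + j)%N) else g 0%N == 0.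
have [||g Pg] := @coefficientwise_choice k 0 P.
- move=> g h [|j] gh /=; first by rewrite gh.
  case/andP=> /eqP g0 /eqP <-; have h0 : h 0%N = 0 by rewrite -gh.
  rewrite h0 eqxx /= -[n in (n + _)%N]mul1n; apply/eqP/esym.
  have [] := @fps_exp_sub k 1 j.+1 n g h (vanishes_below1 g0) (vanishes_below1 h0) _.
    by move=> i lti; rewrite gh.
  by move=> + _; apply; rewrite addnS ltnS.
- move=> g [|[|j]] Pg /=; first by exists 0.
    have [c cn] := @GRing.solve_monicpoly k n (fun i => f n *+ (i == 0%N)) n0.
    have g0 : g 0%N = 0 by apply/eqP/(Pg 0%N).
    exists c; rewrite g0 eqxx /= addn0 -[X in _ X == _]mul1n.
    have [] := @fps_exp_lead k 1 n (fun i => if i == 1%N then c else g i).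
      exact: vanishes_below1.
    move=> _ ->; rewrite /= cn (bigD1 (Ordinal n0)) //= mulr1 big1 ?addr0 //.
    by move=> i; rewrite -val_eqE /= => /negPf->; rewrite mul0r.
  have g0 : g 0%N = 0 by apply/eqP/(Pg 0%N).
  have g1 : g 1%N != 0.
    have := Pg 1%N isT; rewrite /= addn0 => /andP[_ /eqP].
    have [_] := @fps_exp_lead k 1 n g (vanishes_below1 g0); rewrite mul1n => -> eg.
    by apply: contraNneq fn => g1; rewrite -eg g1 expr0n eqn0Ngt n0.
  pose u := g 1%N ^+ n.-1 *+ n.
  have u0 : u != 0.
    by rewrite /u -mulr_natr mulf_neq0 ?expf_neq0 // ((pcharf0P k).1 char0) -lt0n.
  (* The old coefficient plus the error in degree [n + j.+1] divided by the slope [u]. *)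
  pose c := g j.+2 + (f (n + j.+1)%N - (g ^+ n)%fps (n + j.+1)%N) / u.
  exists c; rewrite g0 eqxx /=.
  pose h i := if i == j.+2 then c else g i.
  have [] := @fps_exp_sub k 1 j.+1 n h g (vanishes_below1 g0) (vanishes_below1 g0) _.
    by move=> i lti; rewrite /h eqSS ltn_eqF.
  move=> _ /(_ isT); rewrite mul1n /h eqxx /= /c (addrC (g _)) addrK divfK //.
  by move/addIr->.
exists g; last first.
  move=> i; case: (ltnP i n) => [lti|lei].
    have [+ _] := @fps_exp_lead k 1 n g (vanishes_below1 (eqP (Pg 0%N))).
    by rewrite mul1n => -> //; rewrite fle.
  by have /andP[_ /eqP] := Pg (i - n).+1; rewrite subnKC.
split; last by case=> // _; apply/eqP/(Pg 0%N).
have /andP[_] := Pg 1%N; rewrite addn0.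
have [_] := @fps_exp_lead k 1 n g (vanishes_below1 (eqP (Pg 0%N))).
rewrite mul1n => -> /eqP eg.
by apply: contraNneq fn => g1; rewrite -eg g1 expr0n eqn0Ngt n0.
Qed.

Section Inverse.
Variable k : fieldType.
Implicit Types f g : fps k.

(** Only the linear term of [f] sees the change: for [a >= 2], [g^a] and [h^a] agree in all degrees
    below [a + i], hence in degree [i.+1]. *)
Lemma fps_comp_sub f g h i : g 0%N = 0 -> h 0%N = 0 ->
    (forall j, (j <= i)%N -> g j = h j) ->
  (f \oz g)%fps i.+1 - (f \oz h)%fps i.+1 = f 1%N * (g i.+1 - h i.+1).
Proof.
move=> g0 h0 gh; rewrite /fps_comp -sumrB !big_ord_recl big1 => [|j _].
  by rewrite !(fps_exp1 g, fps_exp1 h) addr0 subrr add0r mulrBr.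
have [] := @fps_exp_sub k 1 i (lift ord0 (lift ord0 j)) g h
  (vanishes_below1 g0) (vanishes_below1 h0) _.
  by move=> a lta; rewrite gh.
move=> agree _; rewrite agree ?subrr // mul1n !lift0.
by rewrite -[i.+1]add1n ltn_add2r.
Qed.

(** By [fps_comp_sub], each new coefficient of [g] enters its equation with slope [f 1], which is
    nonzero. *)
Lemma fps_right_inverse f : in_k1 f ->
  exists2 g, in_k1 g & (f \oz g =1 fps_z k)%fps.
Proof.
move=> [f1 fle]; have f0 : f 0%N = 0 by apply: fle.
pose P g i := (g 0%N == 0) && ((f \oz g)%fps i == fps_z k i).
have [||g Pg] := @coefficientwise_choice k 0 P.
- move=> g h i gh /andP[/eqP g0 /eqP fg].
  have h0 : h 0%N = 0 by rewrite -gh.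
  rewrite /P h0 eqxx -fg eq_sym andTb -subr_eq0; case: i gh {fg} => [|i] gh.
    by rewrite !fps_comp0 subrr eqxx.
  rewrite fps_comp_sub // => [|j lej]; first by rewrite gh // subrr mulr0.
  by rewrite gh // ltnW.
- move=> g [|i] Pg; first by exists 0; rewrite /P fps_comp0 f0 !eqxx.
  have /andP[/eqP g0 _] := Pg 0%N isT.
  pose c := g i.+1 + (fps_z k i.+1 - (f \oz g)%fps i.+1) / f 1%N.
  exists c; rewrite /P g0 eqxx /=.
  pose h j := if j == i.+1 then c else g j.
  change ((f \oz h)%fps i.+1 == fps_z k i.+1).
  have := @fps_comp_sub f h g i g0 g0.
  rewrite {3}/h eqxx /c (addrC (g _)) addrK mulrC divfK // => /(_ _)/addIr-> //.
  by move=> j lej; rewrite /h ltn_eqF.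
have g0 : g 0%N = 0 by have /andP[/eqP] := Pg 0%N.
exists g; last by move=> i; have /andP[_ /eqP] := Pg i.
split; last by case.
have /andP[_ /eqP] := Pg 1%N; rewrite /fps_comp !big_ord_recl big_ord0 /=.
rewrite f0 mul0r add0r addr0 (fps_mulf1 g) => /eqP.
by apply: contraTneq => ->; rewrite mulr0 eq_sym oner_eq0.
Qed.

(** The right inverse [g] of [f] has a right inverse [h] in turn, and
    [f = f o (g o h) = (f o g) o h = h], so [g] is also a left inverse. *)
Lemma fps_inverse f : in_k1 f ->
  exists2 g, in_k1 g & is_comp_inverse g f.
Proof.
move=> fk; have [g gk fg] := fps_right_inverse fk.
have [h hk gh] := fps_right_inverse gk.
have [g0 h0] : g 0%N = 0 /\ h 0%N = 0 by split; [apply: gk.2|apply: hk.2].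
exists g => //; split=> //; suff fh : f =1 h.
  by move=> i; rewrite (eq_fps_comp (frefl g) fh).
move=> i; rewrite -(fps_z_comp h0) -(eq_fps_comp fg (frefl h)) fps_compA //.
by rewrite (eq_fps_comp (frefl f) gh) fps_comp_z.
Qed.

(** Powers [g^i] with [i >= 2] have order above [n], so up to degree [n] the composite is [f 1]
    times [g]. *)
Lemma has_order_comp f g n : (0 < n)%N -> in_k1 f -> has_order g n ->
  has_order (f \oz g)%fps n.
Proof.
move=> n0 [f1 fle] [gn gle]; have f0 : f 0%N = 0 by apply: fle.
have compE i : (i <= n)%N -> (f \oz g)%fps i = f 1%N * g i.
  case: i => [|i] lei; first by rewrite fps_comp0 f0 gle ?mulr0.
  rewrite /fps_comp !big_ord_recl big1 => [|j _].
    by rewrite /= f0 mul0r add0r addr0 (fps_mulf1 g).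
  have [below _] := @fps_exp_lead k n (lift ord0 (lift ord0 j)) g gle.
  rewrite below ?mulr0 // (leq_ltn_trans lei) // !lift0.
  by rewrite -[X in (X < _)%N]muln1 ltn_pmul2l.
split=> [|i lti]; first by rewrite compE ?mulf_neq0.
by rewrite compE ?gle ?mulr0 // ltnW.
Qed.

End Inverse.

(** * Series supported in a residue class *)

Section ResidueClass.
Variable k : fieldType.
Implicit Types f : fps k.

(** Retains only the residue condition from the shape [z^r R(z^m)], so that [r] can be replaced by
    the order of the series. *)
Definition supported_mod (m r : nat) f :=
  forall i, f i != 0 -> i = r %[mod m].

Lemma supported_mod_exp m r n f :
  supported_mod m r f -> supported_mod m (r * n) (f ^+ n)%fps.
Proof.
move=> fr; elim: n => [|n IHn] i.
  by rewrite muln0 fps_exp0 /fps_one; case: (eqVneq i 0%N) => [->|_] //; rewrite eqxx.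
apply: contraNeq => ine; rewrite /= /fps_mul big1 // => a _.
have [->|/fr ar] := eqVneq (f a) 0; first by rewrite mul0r.
have [->|/IHn br] := eqVneq ((f ^+ n)%fps (i - a)%N) 0; first by rewrite mulr0.
case/eqP: ine; rewrite -(subnKC (_ : (a <= i)%N)); last by rewrite -ltnS.
by rewrite mulnS -modnDm ar br modnDm.
Qed.

Lemma supported_mod_zXM m r f : (0 < m)%N ->
  supported_mod m r ('z ^+ r * (f \oz 'z ^+ m))%fps.
Proof.
move=> m0 i; rewrite fps_zXM fps_comp_zX //.
case: ltnP => [|leri]; first by rewrite eqxx.
case: ifP => [/dvdnP[a ar] _|]; last by rewrite eqxx.
by rewrite -(subnK leri) ar modnMDl.
Qed.

(** Recovers the shape [z^e R(z^m)]: exponents congruent to [e] and not below it are [e] plus a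
    multiple of [m]. *)
Lemma supported_mod_factor m e f : (0 < m)%N -> vanishes_below e f ->
  supported_mod m e f ->
  ('z ^+ e * ((fun i => f (e + m * i)%N) \oz 'z ^+ m) =1 f)%fps.
Proof.
move=> m0 fle fm i; rewrite fps_zXM fps_comp_zX //.
case: ltnP => [/fle->//|leei]; case: ifP => [dvd|/negP ndvd].
  by rewrite mulnC divnK // subnKC.
apply/esym/eqP; apply: contra_notT ndvd => /fm/eqP.
by rewrite eqn_mod_dvd.
Qed.

Lemma supported_mod_root m r e n f :
    [pchar k] =i pred0 -> (0 < n)%N -> has_order f e ->
  supported_mod m r (f ^+ n)%fps -> supported_mod m e f.
Proof.
move=> char0 n0 [fe fle] fnr; elim/ltn_ind => i IHi fi.
have lei : (e <= i)%N by case: leqP => // /fle fi0; rewrite fi0 eqxx in fi.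
have [j iE] : exists j, i = (e + j)%N by exists (i - e)%N; rewrite subnKC.
subst i; have [//|ne] := eqVneq ((e + j) %% m)%N (e %% m)%N.
have j0 : (0 < j)%N by case: (j) ne => //; rewrite addn0 eqxx.
(* The part of [f] below the suspect exponent. By induction it lies in the class of [e], so its
   [n]-th power has no term in degree [e * n + j], and [fps_exp_sub] gives that coefficient of [f^n]
   exactly. *)
pose g a := if (a < e + j)%N then f a else 0.
have gm : supported_mod m e g.
  by move=> a; rewrite /g; case: ifP => [lta /(IHi _ lta)|_]; rewrite ?eqxx.
have gle : vanishes_below e g by move=> a /fle fa; rewrite /g fa if_same.
have [] := @fps_exp_sub k e j n f g fle gle _.
  by move=> a lta; rewrite /g ltn_add2l lta.
move=> _ /(_ j0); rewrite {2}/g ltnn subr0.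
have -> : (g ^+ n)%fps (e * n + j)%N = 0.
  apply: contraNeq ne => /(supported_mod_exp gm)/eqP.
  by rewrite -[X in _ == X %[mod m]]addn0 eqn_modDl -{2}[e]addn0 eqn_modDl.
rewrite subr0 => fnE.
have /fnr jr : (f ^+ n)%fps (e * n + j)%N != 0.
  rewrite fnE -mulr_natr !mulf_neq0 ?expf_neq0 //.
  by rewrite ((pcharf0P k).1 char0) -lt0n.
have /fnr er : (f ^+ n)%fps (e * n)%N != 0.
  by rewrite (fps_exp_lead n fle).2 expf_neq0.
(* Both [e * n + j] and [e * n] are congruent to [r], so [m] divides [j]. *)
move/eqP: (etrans jr (esym er)); rewrite -[X in _ == X %[mod m]]addn0 eqn_modDl.
by move=> jm; apply/eqP; rewrite -{2}[e]addn0 eqn_modDl.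
Qed.

End ResidueClass.

End PowerSeries.

Theorem theorem1p4 (k : closedFieldType) (hchar : [pchar k]%R =i pred0)
    (A R : fps k) (m r : nat) (hm : 2 <= m) (hAG : in_Gamma A)
    (hA : A =1 ('z ^+ r * (R \oz 'z ^+ m))%fps)
    (A1 A2 : fps k) (hA1 : in_Gamma A1) (hA2 : in_Gamma A2)
    (hdec : A =1 (A1 \oz A2)%fps) :
  exists (mu mu_inv R1 R2 : fps k) (r1 r2 : nat),
    [/\ in_k1 mu /\ is_comp_inverse mu mu_inv,
        A1 =1 (('z ^+ r1 * (R1 \oz 'z ^+ (m %/ gcdn r2 m))) \oz mu_inv)%fps,
        (* the inner series of A2 has zero constant term, so that the
           composition with mu is defined *)
        ('z ^+ r2 * (R2 \oz 'z ^+ m))%fps 0 = 0%R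
          /\ A2 =1 (mu \oz ('z ^+ r2 * (R2 \oz 'z ^+ m)))%fps &
        r1 * r2 = r %[mod m]].
Proof.
have [n1 n1ge [A1n A1le]] := hA1; have [n2 n2ge [A2n A2le]] := hA2.
have n1pos : 0 < n1 := ltnW n1ge; have n2pos : 0 < n2 := ltnW n2ge.
have mpos : 0 < m := ltnW hm.
have A20 : A2 0 = 0%R by apply: A2le.
have [g gk gA1] := fps_root hchar n1pos (conj A1n A1le).
have g0 : g 0 = 0%R by apply: gk.2.
have [mu muk muP] := fps_inverse gk.
pose B := (g \oz A2)%fps.
have [Bn Ble] : has_order B n2 := has_order_comp n2pos gk (conj A2n A2le).
have BA : (B ^+ n1 =1 A)%fps.
  move=> i; rewrite hdec -(fps_comp_exp _ _ A20).
  exact: eq_fps_comp.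
have Bnr : supported_mod m r (B ^+ n1)%fps.
  by move=> i; rewrite BA hA; apply: supported_mod_zXM.
have Bm := supported_mod_root hchar n1pos (conj Bn Ble) Bnr.
have BE := supported_mod_factor mpos Ble Bm.
(* [R2] collects every [m]-th coefficient of [B], starting from its order [n2]. *)
exists mu, g, (fps_one k), (fun i => B (n2 + m * i)), n1, n2.
split=> //.
- have zE : ('z ^+ n1 * (fps_one k \oz 'z ^+ (m %/ gcdn n2 m)) =1 'z ^+ n1)%fps.
    move=> i; rewrite (eq_fps_mul (frefl _) (fps_one_comp _)).
    exact: fps_mulf1.
  move=> i; rewrite (eq_fps_comp zE (frefl g)) fps_comp_exp //.
  by rewrite (eq_fps_exp _ (fps_z_comp g0)) gA1.
- split; first by rewrite BE Ble.
  move=> i; rewrite (eq_fps_comp (frefl mu) BE) -fps_compA //.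
  have [_ _ gmu] := muP; rewrite -[LHS](fps_z_comp A20).
  by apply: eq_fps_comp => // j; have [_ ] := muP.
(* The leading exponent [n2 * n1] of [B^n1] occurs in [A], hence is congruent to [r]. *)
- rewrite mulnC; apply: Bnr.
  by rewrite (fps_exp_lead n1 Ble).2 GRing.expf_neq0.
Qed.
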